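(* Let $R$ be an associative commutative ring with identity $1\ne0$ and let $\Gamma$ be a finite category. Suppose that the constant $R\Gamma$-module $\underline{R}$ admits a finite free resolution $P_*$. If $P_n$ is free on the finite $\mathrm{ob}(\Gamma)$-set $C_n=\{C_n^y\mid y\in\mathrm{ob}(\Gamma)\}$, that is, $$P_n=\bigoplus_{y\in\mathrm{ob}(\Gamma)}\bigoplus_{C_n^y}R\,\mathrm{mor}(?,y),$$ then the function $k^\bullet\colon\mathrm{ob}(\Gamma)\to\mathbb{Q}$ defined by $$k^y:=\sum_{n\ge0}(-1)^n\cdot|C_n^y|$$ is a weighting on $\Gamma$.
   Context: A small category $\Gamma$ is finite if it has finitely many isomorphism classes of objects and all morphism sets are finite. An $R\Gamma$-module is a functor $\Gamma^{op}\to R\text{-Mod}$ (morphisms: natural transformations; exactness objectwise); $\underline{R}$ is the constant functor with value $R$. $R\,\mathrm{mor}(?,y)$ sends $x$ to the free $R$-module on $\mathrm{mor}(x,y)$. An $\mathrm{ob}(\Gamma)$-set is a family of sets indexed by $\mathrm{ob}(\Gamma)$; it is finite if the disjoint union of its members is finite. A finite free resolution is a resolution $P_*$ with $P_n=0$ for large $n$ in which each $P_n$ is free on a finite $\mathrm{ob}(\Gamma)$-set. A weighting on $\Gamma$ is a function $k^\bullet\colon\mathrm{ob}(\Gamma)\to\mathbb{Q}$ with $\sum_{y\in\mathrm{ob}(\Gamma)}|\mathrm{mor}(x,y)|\cdot k^y=1$ for all objects $x$. *)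

(* Defs.v *)
From HB Require Import structures.
From mathcomp Require Import all_boot all_order all_algebra.
From mathcomp Require Import finmap boolp classical_sets functions.
From mathcomp Require Import cardinality fsbigop.

Set Implicit Arguments.
Unset Strict Implicit.
Unset Printing Implicit Defensive.
Import GRing.Theory.

Local Open Scope classical_set_scope.
Local Open Scope ring_scope.

(* Only meaningful for a finite type: [fset_set] sends infinite sets to the
   empty set. *)
Definition tcard (T : Type) : nat := #|` fset_set [set: {classic T}]|.

Record category := Category {
  ob :> Type;
  mor : ob -> ob -> Type;
  idm : forall x, mor x x;
  comp : forall x y z, mor y z -> mor x y -> mor x z;
  comp_idl : forall x y (f : mor x y), comp (idm y) f = f;
  comp_idr : forall x y (f : mor x y), comp f (idm x) = f;
  compA : forall w x y z (h : mor y z) (g : mor x y) (f : mor w x),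
    comp h (comp g f) = comp (comp h g) f
}.

Definition isomorphic (G : category) (x y : G) : Prop :=
  exists (f : mor x y) (g : mor y x), comp g f = idm x /\ comp f g = idm y.

Definition finite_category (G : category) : Prop :=
  (exists S : set G,
     finite_set S /\ forall x : G, exists2 y : G, S y & isomorphic x y) /\
  (forall x y : G, finite_set [set: mor x y]).

(* The family may have infinitely many objects as index. The big operator
   [\sum_(y \in A)] sums over the finite support of the summand and is 0 when
   that support is infinite, so the equation below also asserts that only
   finitely many terms of the sum are nonzero. *)
Definition weighting (G : category) (k : G -> rat) : Prop :=
  forall x : G,
    \sum_(y \in [set: {classic G}]) ((tcard (mor x y))%:R * k y) = 1.

Section DirectSum.
Variables (R : pzRingType) (I : Type).

Record dirsum (M : I -> lmodType R) := Dirsum {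
  dsval :> forall i, M i;
  dsvalP : finite_set [set i | dsval i != 0]
}.

Section Module.
Variable M : I -> lmodType R.
Implicit Types u v w : dirsum M.

Lemma dirsum_eqP u v : (forall i, u i = v i) -> u = v.
Proof.
case: u v => [f fP] [g gP] /= fg.
have e : f = g by apply: functional_extensionality_dep.
by rewrite -e in gP *; rewrite (Prop_irrelevance fP gP).
Qed.

HB.instance Definition _ := gen_eqMixin (dirsum M).
HB.instance Definition _ := gen_choiceMixin (dirsum M).

Lemma ds0_subproof : finite_set [set i | (0 : M i) != 0].
Proof. by rewrite (_ : mkset _ = set0) // -subset0 => i /=; rewrite eqxx. Qed.

Lemma dsD_subproof u v : finite_set [set i | u i + v i != 0].
Proof.
apply: (@sub_finite_set _ _ ([set i | u i != 0] `|` [set i | v i != 0])).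
  move=> i /=; have [->|ui] := eqVneq (u i) 0; last by left.
  by rewrite add0r; right.
by rewrite finite_setU; split; exact: dsvalP.
Qed.

Lemma dsN_subproof u : finite_set [set i | - u i != 0].
Proof.
by apply: sub_finite_set (dsvalP u) => i /=; rewrite oppr_eq0.
Qed.

Lemma dsZ_subproof (a : R) u : finite_set [set i | a *: u i != 0].
Proof.
apply: sub_finite_set (dsvalP u) => i /=.
by apply: contra_neq => ->; rewrite scaler0.
Qed.

Definition ds0 : dirsum M := Dirsum ds0_subproof.
Definition dsD u v : dirsum M := Dirsum (dsD_subproof u v).
Definition dsN u : dirsum M := Dirsum (dsN_subproof u).
Definition dsZ a u : dirsum M := Dirsum (dsZ_subproof a u).

Lemma dsDA : associative dsD.
Proof. by move=> u v w; apply: dirsum_eqP => i /=; rewrite addrA. Qed.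
Lemma dsDC : commutative dsD.
Proof. by move=> u v; apply: dirsum_eqP => i /=; rewrite addrC. Qed.
Lemma ds0D : left_id ds0 dsD.
Proof. by move=> u; apply: dirsum_eqP => i /=; rewrite add0r. Qed.
Lemma dsND : left_inverse ds0 dsN dsD.
Proof. by move=> u; apply: dirsum_eqP => i /=; rewrite addNr. Qed.

HB.instance Definition _ :=
  GRing.isZmodule.Build (dirsum M) dsDA dsDC ds0D dsND.

Lemma dsZA a b u : dsZ a (dsZ b u) = dsZ (a * b) u.
Proof. by apply: dirsum_eqP => i /=; rewrite scalerA. Qed.
Lemma ds1Z : left_id 1 dsZ.
Proof. by move=> u; apply: dirsum_eqP => i /=; rewrite scale1r. Qed.
Lemma dsZDr : right_distributive dsZ +%R.
Proof. by move=> a u v; apply: dirsum_eqP => i /=; rewrite scalerDr. Qed.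
Lemma dsZDl u : {morph dsZ^~ u : a b / a + b}.
Proof. by move=> a b; apply: dirsum_eqP => i /=; rewrite scalerDl. Qed.

HB.instance Definition _ :=
  GRing.Zmodule_isLmodule.Build R (dirsum M) dsZA ds1Z dsZDr dsZDl.

Lemma dirsum0E i : (0 : dirsum M) i = 0. Proof. by []. Qed.
Lemma dirsumDE u v i : (u + v) i = u i + v i. Proof. by []. Qed.
Lemma dirsumZE a u i : (a *: u) i = a *: u i. Proof. by []. Qed.

End Module.

Section Map.
Variables (M N : I -> lmodType R) (f : forall i, {linear M i -> N i}).

Lemma dirsum_map_subproof (u : dirsum M) :
  finite_set [set i | f i (u i) != 0].
Proof.
apply: sub_finite_set (dsvalP u) => i /=.
by apply: contra_neq => ->; rewrite linear0.
Qed.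

Definition dirsum_map (u : dirsum M) : dirsum N :=
  Dirsum (dirsum_map_subproof u).

Lemma dirsum_map_linear : linear dirsum_map.
Proof. by move=> a u v; apply: dirsum_eqP => i /=; rewrite linearP. Qed.

HB.instance Definition _ :=
  GRing.isLinear.Build R (dirsum M) (dirsum N) _ dirsum_map dirsum_map_linear.

End Map.
End DirectSum.

Section FreeModule.
Variable R : pzRingType.

Definition freemod (T : Type) : lmodType R :=
  dirsum (fun _ : T => R^o : lmodType R).

Section Map.
Variables (S T : Type) (h : S -> T).

Definition fpush (u : freemod S) (t : T) : R^o :=
  \sum_(s \in (h @^-1` [set t] : set {classic S})) (u : dirsum _) s.

Lemma fpush_subproof (u : freemod S) : finite_set [set t | fpush u t != 0].
Proof.
apply: sub_finite_set (finite_image h (dsvalP u)) => t /= ut.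
apply: contrapT => nt; move/eqP: ut; apply; rewrite /fpush fsbig1 // => s /= st.
by apply: contrapT => /eqP us; apply: nt; exists s.
Qed.

(* The linear extension of [h]: it sends a basis element [s] to [h s]. *)
Definition freemap (u : freemod S) : freemod T :=
  Dirsum (fpush_subproof u).

Lemma fpush_sum (u : freemod S) (A : set {classic S}) (t : T) :
    finite_set A -> [set s | (u : dirsum _) s != 0] `<=` A ->
  fpush u t =
    \sum_(s <- fset_set A) (if `[< h s = t >] then (u : dirsum _) s else 0).
Proof.
move=> Afin uA; rewrite /fpush fsbig_mkcond (fsbigTE (fset_set A)); last first.
  move=> s; rewrite in_fset_set // notin_setE => As; rewrite /patch.
  by case: ifP => // _; apply: contrapT => /eqP us; exact/As/uA.
apply: eq_bigr => s _; rewrite /patch.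
have -> // : (s \in (h @^-1` [set t] : set {classic S})) = `[< h s = t >].
by apply/idP/asboolP; rewrite in_setE.
Qed.

Lemma freemap_linear : linear freemap.
Proof.
move=> a u v; apply: dirsum_eqP => t /=.
pose A : set {classic S} :=
  [set s | (u : dirsum _) s != 0] `|` [set s | (v : dirsum _) s != 0].
have Afin : finite_set A by rewrite finite_setU; split; exact: dsvalP.
rewrite (@fpush_sum u A) //; last by move=> s us; left.
rewrite (@fpush_sum v A) //; last by move=> s us; right.
rewrite (@fpush_sum _ A) //; last first.
  move=> s /=; have [us|us] := eqVneq ((u : dirsum _) s) 0; last by left.
  by rewrite us scaler0 add0r; right.
rewrite scaler_sumr -big_split /=; apply: eq_bigr => s _.
by case: ifP => //; rewrite scaler0 addr0.
Qed.

HB.instance Definition _ :=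
  GRing.isLinear.Build R (freemod S) (freemod T) _ freemap freemap_linear.

End Map.

Lemma freemap_id T (h : T -> T) : h =1 id -> freemap h =1 id.
Proof.
move=> hE u; apply: dirsum_eqP => t /=; rewrite /fpush.
rewrite (_ : h @^-1` [set t] = [set t]) ?fsbig_set1 //.
by rewrite predeqE => s /=; rewrite hE.
Qed.

Lemma freemap_comp S T U (g : T -> U) (h : S -> T) (k : S -> U) :
  (forall s, k s = g (h s)) -> freemap k =1 freemap g \o freemap h.
Proof.
move=> kE u; apply: dirsum_eqP => t /=.
pose A : set {classic S} := [set s | (u : dirsum _) s != 0].
have Afin : finite_set A by exact: dsvalP.
pose B : set {classic T} := h @` A.
have Bfin : finite_set B by exact: finite_image.
rewrite (@fpush_sum _ _ k u A) // (@fpush_sum _ _ g (freemap h u) B) //.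
  under [RHS]eq_bigr => r _ do rewrite /= (@fpush_sum _ _ h u A) //.
  under [RHS]eq_bigr => r _.
    rewrite (_ : (if _ then _ else _) = \sum_(s <- fset_set A)
      (if `[< g r = t >] && `[< h s = r >] then (u : dirsum _) s else 0)); last first.
      by case: ifP => //= _; rewrite big1.
    over.
  rewrite exchange_big /= big_seq_cond [RHS]big_seq_cond.
  apply: eq_bigr => s /andP[]; rewrite in_fset_set // in_setE => As _.
  rewrite (bigD1_seq (h s : {classic T})) ?fset_uniq //=; last first.
    by rewrite in_fset_set // in_setE; exists s.
  rewrite big1 ?addr0 => [|r rh].
    by rewrite kE (asboolT (erefl (h s))) andbT.
  by rewrite [in X in _ && X]asboolF ?andbF // => e; rewrite e eqxx in rh.
move=> r /= /eqP ur; apply: contrapT => Br; apply: ur.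
rewrite /fpush fsbig1 // => s /= hs.
by apply: contrapT => /eqP us; apply: Br; exists s.
Qed.

End FreeModule.

Section RGModules.
Variables (R : comNzRingType) (G : category).

Record rgmod := Rgmod {
  rgobj :> G -> lmodType R;
  rgact : forall x y, mor x y -> {linear rgobj y -> rgobj x};
  rgact_id : forall x (v : rgobj x), rgact (idm x) v = v;
  rgact_comp : forall x y z (g : mor y z) (f : mor x y) (v : rgobj z),
    rgact (comp g f) v = rgact f (rgact g v)
}.

Record rghom (M N : rgmod) := Rghom {
  rgfun :> forall x, {linear M x -> N x};
  rgnat : forall x y (f : mor x y) (v : M y),
    rgfun x (rgact M f v) = rgact N f (rgfun y v)
}.

Definition rgiso (M N : rgmod) : Prop :=
  exists (f : rghom M N) (g : rghom N M),
    forall x, cancel (f x) (g x) /\ cancel (g x) (f x).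

Definition rgzero (M : rgmod) : Prop := forall x (v : M x), v = 0.

Definition rgsurj (M N : rgmod) (f : rghom M N) : Prop :=
  forall x (w : N x), exists v : M x, f x v = w.

Definition rgexact (M N K : rgmod) (f : rghom M N) (g : rghom N K) : Prop :=
  forall x (w : N x), g x w = 0 <-> exists v : M x, f x v = w.

Definition constmod : rgmod :=
  @Rgmod (fun _ => R^o) (fun _ _ _ => idfun)
    (fun _ _ => erefl) (fun _ _ _ _ _ _ => erefl).

Definition rmor (y : G) : rgmod.
Proof.
refine (@Rgmod (fun x => freemod R (mor x y))
  (fun x x' f => freemap (fun g : mor x' y => comp g f)) _ _).
- by move=> x v; apply: freemap_id => g; exact: comp_idr.
- by move=> x x' x'' g f v; apply: freemap_comp => h; exact: compA.
Defined.

Definition rgsum (I : Type) (M : I -> rgmod) : rgmod.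
Proof.
refine (@Rgmod (fun x => dirsum (fun i => M i x))
  (fun x y f => dirsum_map (fun i => rgact (M i) f)) _ _).
- by move=> x v; apply: dirsum_eqP => i /=; exact: rgact_id.
- by move=> x y z g f v; apply: dirsum_eqP => i /=; exact: rgact_comp.
Defined.

Definition rgfree (C : G -> Type) : rgmod :=
  rgsum (fun y : G => rgsum (fun _ : C y => rmor y)).

Record resolution (M : rgmod) := Resolution {
  resobj :> nat -> rgmod;
  resdiff : forall n, rghom (resobj n.+1) (resobj n);
  resaug : rghom (resobj 0%N) M;
  resaug_surj : rgsurj resaug;
  res_exact0 : rgexact (resdiff 0%N) resaug;
  res_exact : forall n, rgexact (resdiff n.+1) (resdiff n)
}.

End RGModules.

Definition finite_obset (G : category) (C : G -> Type) : Prop :=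
  finite_set [set: {y : G & C y}].

(* Main.v *)
From HB Require Import structures.
Require Import Defs.
From mathcomp Require Import all_boot all_order all_algebra finmap.
From mathcomp Require Import boolp classical_sets functions.
From mathcomp Require Import cardinality fsbigop.
From mathcomp Require Import ring.

(** The proof evaluates the resolution at one object x at a time. There it
    becomes a bounded exact complex of free R-modules
    [... -> P_1(x) -> P_0(x) -> R -> 0], and P_n(x) has the finite rank
    [\sum_y |C_n^y| * |mor(x,y)|] ([rgfree_free], an instance of the rank
    formula [dirsum_free] for direct sums). The Euler characteristic of such a
    complex vanishes ([acyclic_euler_char]), so that
    [1 = \sum_n (-1)^n \sum_y |C_n^y| * |mor(x,y)|]; exchanging the two finite
    sums gives the weighting equation at x.

    Over a field the Euler characteristic would be computed by counting
    dimensions of kernels. Over a general commutative ring the kernels are only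
    stably free, and [mx_acyclic_euler_char] avoids them: since the last map
    [F_1 -> F_0] is a split surjection, the complex can be replaced by
    [... -> F_3 -> F_2 + F_0 -> F_1 -> 0], where F_0 enters through the
    splitting. This complex is again exact and free, it is shorter by one, and
    it has the opposite Euler characteristic. When only F_1 and F_0 are left,
    the map between them is an isomorphism, and their ranks agree because a
    nonzero commutative ring has invariant basis number ([mulmx1_min]).

    The ranks |C_n^y| in degrees where P_n vanishes must be shown to be zero,
    so that the defining sum of k^y stops: the summand of P_n(y) indexed by y
    has rank |C_n^y| * |mor(y,y)|, and mor(y,y) contains the identity. *)

Set Implicit Arguments.
Unset Strict Implicit.
Unset Printing Implicit Defensive.
Import GRing.Theory.

Local Open Scope classical_set_scope.
Local Open Scope ring_scope.

(** * Acyclic complexes of matrices *)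

Section MatrixComplex.
Variable R : comNzRingType.

(** Row vectors are multiplied on the left, so [D n] is a map from degree
    [n.+1] to degree [n], and the complex ends with the surjection [D 0]. *)
Definition mx_acyclic (m : nat -> nat) (D : forall n, 'M[R]_(m n.+1, m n)) :=
  (forall w : 'rV_(m 0), exists v, v *m D 0 = w) /\
  (forall n (w : 'rV_(m n.+1)), w *m D n = 0 <-> exists v, v *m D n.+1 = w).

Lemma surjective_mx_section p q (A : 'M[R]_(p, q)) :
  (forall w : 'rV_q, exists v, v *m A = w) -> exists S, S *m A = 1%:M.
Proof.
move=> surjA; have [s sA] := choice surjA.
exists (\matrix_i s (row i 1%:M)).
by apply/row_matrixP => i; rewrite row_mul rowK.
Qed.

(** With nothing in degree 2 the surjection [D 0] is also injective, so its
    section is a two-sided inverse and invariant basis number applies. *)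
Lemma mx_acyclic_length1 m (D : forall n, 'M[R]_(m n.+1, m n)) :
  mx_acyclic D -> m 2 = 0%N -> m 0 = m 1.
Proof.
move=> [surjD exD] m2; have [S SD] := surjective_mx_section surjD.
have DS : D 0%N *m S = 1%:M.
  apply/row_matrixP => i; apply/subr0_eq; rewrite -linearB /=.
  have /exD[v <-] : row i (D 0%N *m S - 1%:M) *m D 0%N = 0.
    by rewrite -row_mul mulmxBl -mulmxA SD mul1mx mulmx1 subrr row0.
  by move: (D 1%N) v; rewrite m2 => A v; rewrite (thinmx0 v) mul0mx.
by apply/eqP; rewrite eqn_leq (mulmx1_min SD) (mulmx1_min DS).
Qed.

Definition splice_rank (m : nat -> nat) (n : nat) : nat :=
  match n with 0 => m 1 | 1 => (m 2 + m 0)%N | _ => m n.+1 end.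

(** The complex [... -> F_3 -> F_2 + F_0 -> F_1 -> 0] obtained from
    [... -> F_1 -> F_0 -> 0] by letting F_0 re-enter through [S]. *)
Definition splice_diff m (D : forall n, 'M[R]_(m n.+1, m n))
    (S : 'M_(m 0, m 1)) n : 'M[R]_(splice_rank m n.+1, splice_rank m n) :=
  match n with
  | 0 => col_mx (D 1) S
  | 1 => row_mx (D 2) 0
  | n'.+2 => D n'.+3
  end.

(** As [S] splits [D 0], F_1 is the direct sum of the image of [S] and the
    kernel of [D 0], which is the image of [D 1]. Hence the new last map is
    surjective, and (a, b) is in its kernel only if b = 0 and a is in the
    kernel of [D 1]. *)
Lemma splice_acyclic m (D : forall n, 'M[R]_(m n.+1, m n)) S :
  S *m D 0 = 1%:M -> mx_acyclic D -> mx_acyclic (splice_diff D S).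
Proof.
move=> SD [_ exD].
have DD n (v : 'rV_(m n.+2)) : v *m D n.+1 *m D n = 0 by apply/exD; exists v.
split=> [w|[|[|n]] w] /=; last exact: exD.
- have /(exD 0%N)[v vE] : (w - w *m D 0%N *m S) *m D 0%N = 0.
    by rewrite mulmxBl -(mulmxA _ S) SD mulmx1 subrr.
  by exists (row_mx v (w *m D 0%N)); rewrite mul_row_col vE subrK.
- split=> [|[v <-]]; last first.
    by rewrite -mulmxA mul_row_col mul0mx addr0 mulmxA DD.
  rewrite -[w]hsubmxK mul_row_col => w0.
  have r0 : rsubmx w = 0.
    have := congr1 (mulmx^~ (D 0%N)) w0.
    by rewrite mulmxDl DD add0r mul0mx -mulmxA SD mulmx1.
  move: w0; rewrite r0 mul0mx addr0 => /(exD 1%N)[v <-].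
  by exists v; rewrite mul_mx_row mulmx0.
- split=> [|[v <-]]; rewrite mul_mx_row mulmx0.
    by rewrite -row_mx0 => /eq_row_mx[/(exD 2%N)].
  by rewrite DD row_mx0.
Qed.

(** Splicing shortens the complex and negates the alternating sum: the terms
    m 1 and m 2 + m 0 appear in degrees 0 and 1. *)
Lemma mx_acyclic_euler_char m (D : forall n, 'M[R]_(m n.+1, m n)) N :
  mx_acyclic D -> (forall n, (N.+2 <= n)%N -> m n = 0%N) ->
  \sum_(n < N.+2) (-1 : rat) ^+ n * (m n)%:R = 0.
Proof.
elim: N m D => [|N IH] m D acD m0.
  rewrite !big_ord_recl big_ord0 /= (mx_acyclic_length1 acD (m0 2%N isT)).
  by rewrite expr0 expr1 mul1r mulN1r addr0 subrr.
have [S SD] := surjective_mx_section acD.1.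
have := IH _ _ (splice_acyclic SD acD).
have h n : (N.+2 <= n)%N -> splice_rank m n = 0%N.
  by case: n => [|[|n]] // nN; exact: m0.
move=> /(_ h); rewrite !big_ord_recl /= /bump /= => e.
under eq_bigr => i _ do rewrite [X in X * _]exprS mulN1r mulNr.
by apply: oppr_inj; rewrite sumrN oppr0 -[RHS]e natrD !add1n; ring.
Qed.

End MatrixComplex.

(** * Free modules of finite rank *)

Definition free_of_rank (R : pzRingType) (M : lmodType R) (n : nat) :=
  exists f : {linear M -> 'rV[R]_n}, bijective f.

Lemma free_of_rank_linear (R : pzRingType) (M : lmodType R) n
    (f : M -> 'rV[R]_n) :
  linear f -> bijective f -> free_of_rank M n.
Proof.
by move=> linf; exists (HB.pack_for {linear M -> 'rV[R]_n} f
  (GRing.isLinear.Build _ _ _ _ f linf)).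
Qed.

Lemma free_of_rank_inverse (R : pzRingType) (M : lmodType R) n :
  free_of_rank M n -> exists (f : {linear M -> 'rV[R]_n})
    (g : {linear 'rV[R]_n -> M}), cancel f g /\ cancel g f.
Proof.
move=> [f [g fK gK]]; exists f.
by exists (HB.pack_for {linear 'rV[R]_n -> M} g
  (GRing.isLinear.Build _ _ _ _ g (can2_linear fK gK))).
Qed.

Lemma free_of_rank_iso (R : pzRingType) (M N : lmodType R) n
    (f : {linear M -> N}) :
  bijective f -> free_of_rank N n -> free_of_rank M n.
Proof.
by move=> bf [g bg]; exists (g \o f : {linear _ -> _}); exact: bij_comp.
Qed.

Lemma free_of_rank_zero (R : nzRingType) (M : lmodType R) n :
  free_of_rank M n -> (forall v : M, v = 0) -> n = 0%N.
Proof.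
case: n => // n [f [g _ gK]] M0.
have /matrixP/(_ 0 0)/eqP := gK (const_mx 1).
by rewrite (M0 (g _)) linear0 !mxE eq_sym oner_eq0.
Qed.

Lemma free_of_rank_ring (R : pzRingType) : free_of_rank (R^o : lmodType R) 1.
Proof.
pose f (a : R^o) : 'rV[R]_1 := a%:M.
have lin : linear f by move=> a u v; rewrite /f raddfD /= scale_scalar_mx.
apply: (free_of_rank_linear lin).
exists (fun v : 'rV_1 => v 0 0) => [a|v]; first by rewrite mxE.
by apply/rowP => i; rewrite (ord1 i) mxE.
Qed.

(** Choosing coordinates in every degree turns the differentials into
    matrices, to which [mx_acyclic_euler_char] applies. *)
Lemma acyclic_euler_char (R : comNzRingType) (Q : nat -> lmodType R)
    (d : forall n, {linear Q n.+1 -> Q n}) (r : nat -> nat) N :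
    (forall n, free_of_rank (Q n) (r n)) ->
    (forall w, exists v, d 0 v = w) ->
    (forall n w, d n w = 0 <-> exists v, d n.+1 v = w) ->
    (forall n, (N.+2 <= n)%N -> r n = 0%N) ->
  \sum_(n < N.+2) (-1 : rat) ^+ n * (r n)%:R = 0.
Proof.
move=> freeQ surjd exd r0.
have /(_ _)/cid iso n := free_of_rank_inverse (freeQ n).
pose f n := sval (iso n).
have /(_ _)/cid iso' n : exists g : {linear 'rV_(r n) -> Q n},
    cancel (f n) g /\ cancel g (f n) by exact: svalP (iso n).
pose g n := sval (iso' n).
have fK n : cancel (f n) (g n) by case: (svalP (iso' n)).
have gK n : cancel (g n) (f n) by case: (svalP (iso' n)).
pose D n : 'M[R]_(r n.+1, r n) := lin1_mx (f n \o d n \o g n.+1).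
have DE n v : v *m D n = f n (d n (g n.+1 v)) by rewrite mul_rV_lin1.
apply: (@mx_acyclic_euler_char R r D) => //; split=> [w|n w].
  by have [v vE] := surjd (g 0%N w); exists (f 1%N v); rewrite DE fK vE gK.
rewrite DE; split=> [w0|[v <-]].
  have /exd[v vE] : d n (g n.+1 w) = 0.
    by apply: (can_inj (fK n)); rewrite w0 linear0.
  by exists (f n.+2 v); rewrite DE fK vE gK.
rewrite DE fK; suff -> : d n (d n.+1 (g n.+2 v)) = 0 by rewrite linear0.
by apply/exd; exists (g n.+2 v).
Qed.

(** * Ranks of direct sums *)

(** Coordinates on the direct sum are indexed by the finite type [K] of pairs
    of an index in [A] and a coordinate of the corresponding summand. Indices
    outside [A] contribute nothing, because a free module of rank 0 has a
    single element; this also gives the finite supports. *)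
Lemma dirsum_free (R : pzRingType) (I : Type) (M : I -> lmodType R)
    (r : I -> nat) (A : {fset {classic I}}) :
    (forall i, free_of_rank (M i) (r i)) ->
    (forall i : {classic I}, i \notin A -> r i = 0%N) ->
  free_of_rank (dirsum M) (\sum_(i <- A) r i).
Proof.
move=> freeM rA.
have /(_ _)/cid iso i := freeM i.
pose f i := sval (iso i).
have /(_ _)/cid2 inv i : exists2 g, cancel (f i) g & cancel g (f i).
  by case: (svalP (iso i)) => g ? ?; exists g.
pose g i := s2val (inv i).
have fK i : cancel (f i) (g i) by exact: (s2valP (inv i)).
have gK i : cancel (g i) (f i) by exact: (s2valP' (inv i)).
pose K : finType := {i : A & 'I_(r (val i))}.
have cardK : #|K| = \sum_(i <- A) r i.
  rewrite card_tagged sumnE big_map big_enum /= big_seq_fsetE /=.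
  by apply: eq_bigr => i _; rewrite card_ord.
rewrite -cardK.
pose F (u : dirsum M) : 'rV[R]_#|K| :=
  \row_k let k' : K := enum_val k in
         f (val (tag k')) (u (val (tag k'))) 0 (tagged k').
have linF : linear F.
  by move=> a u v; apply/rowP => k; rewrite !mxE /= linearP !mxE.
apply: (free_of_rank_linear linF).
have FE u (k : K) : F u 0 (enum_rank k) =
    f (val (tag k)) (u (val (tag k))) 0 (tagged k).
  by rewrite mxE enum_rankK.
have M0 i (v w : M i) : (i : {classic I}) \notin A -> v = w.
  move=> /rA ri; apply: (can_inj (fK i)).
  by move: (f i v) (f i w); rewrite ri => x y; rewrite (thinmx0 x) (thinmx0 y).
have surjF v : exists u, F u = v.
  (* Quantifying over the proofs of [i \in A] lets the component at [i] live
     in [M i] itself, without transport along an equality of indices. *)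
  have /(_ _)/cid comp (i : {classic I}) : exists w : M i,
      forall iA : i \in A, w = g i (\row_l v 0 (enum_rank
        (Tagged (fun j : A => 'I_(r (val j)))
                (l : 'I_(r (val [` iA]%fset)))))).
    have [iA|iA] := pselect (i \in A); last by exists 0.
    eexists => iA'; rewrite (bool_irrelevance iA' iA); reflexivity.
  have fin : finite_set [set i | sval (comp i) != 0].
    apply: (sub_finite_set _ (finite_fset A)) => i /=; apply: contraNT => iA.
    exact/eqP/M0.
  exists (Dirsum fin); apply/rowP => k; rewrite -(enum_valK k) FE.
  move: (enum_val k) => {k} [[i iA] l] /=.
  by rewrite (svalP (comp i) iA) gK mxE.
have injF u v : F u = F v -> u = v.
  move=> Fuv; apply: dirsum_eqP => i.
  have [iA|iA] := boolP ((i : {classic I}) \in A); last exact: M0.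
  apply: (can_inj (fK i)); apply/rowP => l.
  pose k : K := Tagged (fun j : A => 'I_(r (val j)))
                       (l : 'I_(r (val [` iA]%fset))).
  by have /rowP/(_ (enum_rank k)) := Fuv; rewrite !FE.
have /(_ _)/cid surj v := surjF v.
exists (fun v => sval (surj v)) => [u|v]; last exact: svalP (surj v).
exact/injF/(svalP (surj (F u))).
Qed.

Lemma dirsum_free_const (R : pzRingType) (T : Type) (M : T -> lmodType R) n :
    finite_set [set: T] -> (forall t, free_of_rank (M t) n) ->
  free_of_rank (dirsum M) (tcard T * n).
Proof.
move=> finT freeM.
have -> : (tcard T * n = \sum_(t <- fset_set [set: {classic T}]) n)%N.
  by rewrite big_const_seq iter_addn_0 count_predT mulnC.
by apply: dirsum_free => // t; rewrite in_fset_set // in_setT.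
Qed.

Lemma freemod_free (R : pzRingType) (T : Type) :
  finite_set [set: T] -> free_of_rank (freemod R T) (tcard T).
Proof.
move=> finT; rewrite -[tcard T]muln1.
by apply: dirsum_free_const => // t; exact: free_of_rank_ring.
Qed.

Lemma tcard_gt0 (T : Type) (t : T) : finite_set [set: T] -> (0 < tcard T)%N.
Proof.
move=> finT; rewrite cardfs_gt0; apply/fset0Pn; exists t.
by rewrite in_fset_set //; exact: mem_set.
Qed.

Lemma tcard_inhabited (T : Type) : tcard T <> 0%N -> inhabited T.
Proof.
move=> T0; apply: contrapT => nT; apply: T0; rewrite /tcard.
rewrite (_ : [set: _] = set0) ?fset_set0 //.
by rewrite -subset0 => t _; apply: nT; exists.
Qed.

(** Any finite set [A] containing the objects y with nonempty [C y] may be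
    used, so that one set can serve for several families [C]. *)
Lemma rgfree_free (R : comNzRingType) (G : category) (C : G -> Type) (x : G)
    (A : {fset {classic G}}) :
    (forall y : G, finite_set [set: mor x y]) -> finite_obset C ->
    (forall y : {classic G}, y \notin A -> tcard (C y) = 0%N) ->
  free_of_rank (rgfree R C x) (\sum_(y <- A) tcard (C y) * tcard (mor x y)).
Proof.
move=> finmor finC CA.
have finCy y : finite_set [set: C y].
  rewrite -(preimage_setT (existT C y)); apply: finite_preimage finC.
  by move=> c c' _ _; exact: (@existT_inj2 {classic G}).
apply: dirsum_free => [y|y /CA -> //].
by apply: dirsum_free_const => // c; exact: freemod_free.
Qed.

(** * The weighting of a finite free resolution *)

Theorem theorem7p6 (R : comNzRingType) (G : category)
    (G_finite : finite_category G)
    (P : resolution (constmod R G))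
    (P_bounded : exists N : nat, forall n : nat, (N <= n)%N -> rgzero (P n))
    (C : nat -> G -> Type)
    (C_finite : forall n : nat, finite_obset (C n))
    (P_free : forall n : nat, rgiso (P n) (rgfree R (C n))) :
  weighting (fun y : G =>
    \sum_(n \in [set: nat]) ((-1 : rat) ^+ n * (tcard (C n y))%:R)).
Proof.
have finmor := G_finite.2; have [N P0] := P_bounded.
pose supp n : set {classic G} := [set y | tcard (C n y) != 0%N].
have fin_supp n : finite_set (supp n).
  apply: sub_finite_set (finite_image (@projT1 G (C n)) (C_finite n)) => y.
  by move=> /= /eqP /tcard_inhabited[] => c; exists (existT _ y c).
have P_rank n x (B : {fset {classic G}}) :
    (forall y : {classic G}, y \notin B -> tcard (C n y) = 0%N) ->
  free_of_rank (P n x) (\sum_(y <- B) tcard (C n y) * tcard (mor x y)).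
  move=> CB; have [f [g fg]] := P_free n; have [fK gK] := fg x.
  apply: (@free_of_rank_iso _ _ _ _ (f x)); first by exists (g x).
  exact: rgfree_free.
(* The basis of P_n(y) contains C_n^y times the identity of y. *)
have C0 n (y : {classic G}) : (N <= n)%N -> tcard (C n y) = 0%N.
  move=> /P0 Pn0; apply/eqP/negP => /negP y0.
  have CB (z : {classic G}) :
      z \notin fset_set (supp n) -> tcard (C n z) = 0%N.
    by rewrite in_fset_set // notin_setE => /negP/negPn/eqP.
  have /eqP := free_of_rank_zero (P_rank n y _ CB) (Pn0 y).
  rewrite sum_nat_seq_eq0 => /allP/(_ y).
  rewrite in_fset_set // muln_eq0 (negPf y0) /= => /(_ (mem_set y0)).
  by apply/negP; rewrite -lt0n (tcard_gt0 (idm y)).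
move=> x; pose A : {fset {classic G}} := fset_set (\bigcup_(n in `I_N) supp n).
have fin_A : finite_set (\bigcup_(n in `I_N) supp n) by exact: bigcup_finite.
have CA n (y : {classic G}) : y \notin A -> tcard (C n y) = 0%N.
  rewrite in_fset_set // notin_setE => yA.
  have [/C0 //|nN] := leqP N n.
  by apply: contrapT => /eqP y0; apply: yA; exists n.
have kE y : \sum_(n \in [set: nat]) ((-1 : rat) ^+ n * (tcard (C n y))%:R) =
    \sum_(n < N.+1) (-1) ^+ n * (tcard (C n y))%:R.
  rewrite (fsbig_ord _ _ (fun n => (-1) ^+ n * (tcard (C n y))%:R)).
  rewrite [RHS](fsbig_widen _ setT) // => n /= [_ /negP].
  by rewrite -leqNgt => /ltnW/C0 ->; rewrite mulr0.
(* The augmented resolution, with the constant module in degree 0. *)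
pose r n := if n is n'.+1
  then (\sum_(y <- A) tcard (C n' y) * tcard (mor x y))%N else 1%N.
pose Q n : lmodType R := if n is n'.+1 then P n' x else constmod R G x.
pose d n : {linear Q n.+1 -> Q n} :=
  match n with 0 => resaug P x | n'.+1 => resdiff P n' x end.
have : \sum_(n < N.+2) (-1 : rat) ^+ n * (r n)%:R = 0.
  apply: (@acyclic_euler_char R Q d r N).
  - by case=> [|n]; [exact: free_of_rank_ring | apply: P_rank; exact: CA].
  - exact: (@resaug_surj _ _ _ P).
  - case=> [|n]; first exact: (@res_exact0 _ _ _ P).
    exact: (@res_exact _ _ _ P).
  - by case=> // n nN; rewrite /r big1 // => y _; rewrite C0 ?mul0n // ltnW.
rewrite big_ord_recl expr0 mul1r.
under eq_bigr do rewrite lift0 exprS mulN1r mulNr.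
rewrite sumrN => /subr0_eq/esym euler; rewrite -[RHS]/((r 0)%:R) -[RHS]euler.
rewrite (fsbigTE A) => [|y /CA y0]; last first.
  by rewrite kE big1 ?mulr0 // => n _; rewrite y0 mulr0.
under eq_bigr do rewrite kE mulr_sumr.
rewrite exchange_big /=; apply: eq_bigr => n _.
rewrite natr_sum mulr_sumr; apply: eq_bigr => y _.
by rewrite mulrCA natrM [in RHS](mulrC _%:R).
Qed.
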